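(* Let $\underline{x},\overline{x},\underline{y},\overline{y}$ be real numbers with $0<\underline{x}<\overline{x}$ and $0<\underline{y}<\overline{y}$. Then the convex hull of the set $$\mathcal{S}_2=\{(x,z_1,z_2)\in\mathbb{R}^3 : \underline{x}\le x\le \overline{x},\ x/\overline{y}\le z_1\le x/\underline{y},\ z_2=z_1^2/x\}$$ is $$\overline{\mathcal{S}}_2=\{(x,z_1,z_2)\in\mathbb{R}^3 : \underline{x}\le x\le \overline{x},\ z_1^2\le x z_2,\ x+\underline{y}\,\overline{y}\,z_2\le(\underline{y}+\overline{y})z_1\}.$$ *)

(* Defs.v *)
From mathcomp Require Import all_boot all_order all_algebra.
From mathcomp Require Import boolp classical_sets reals convex.

Set Implicit Arguments.
Unset Strict Implicit.
Unset Printing Implicit Defensive.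

Import Order.TTheory GRing.Theory Num.Theory.

Local Open Scope classical_set_scope.
Local Open Scope ring_scope.

(* smallest C A is the intersection of all sets satisfying C and containing A. *)
Definition convex_hull (R : numDomainType) (M : lmodType R) (A : set M) :
  set M := smallest (@convex_set R M) A.

(* A point (x, z1, z2) of R^3 is a row vector with entries at 0, 1, 2 : 'I_3. *)
Definition S2 (R : realType) (xl xu yl yu : R) : set 'rV[R]_3 :=
  [set v | let x := v 0 0 in let z1 := v 0 1 in let z2 := v 0 2 in
    [/\ xl <= x <= xu, x / yu <= z1 <= x / yl & z2 = z1 ^+ 2 / x]].

Definition S2_relax (R : realType) (xl xu yl yu : R) : set 'rV[R]_3 :=
  [set v | let x := v 0 0 in let z1 := v 0 1 in let z2 := v 0 2 in
    [/\ xl <= x <= xu, z1 ^+ 2 <= x * z2 &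
        x + yl * yu * z2 <= (yl + yu) * z1]].

(* Main.v *)
(* For fixed x the slice of S2 is an arc of the parabola x z2 = z1^2, and the
   slice of the relaxation is the region between this arc and its chord.  The
   relaxation is convex because z1^2 <= x z2 is a rotated second-order cone.
   Conversely, a point of a slice lies on the vertical segment between a point
   of the arc and a point of the chord, and the latter is a convex combination
   of the end points of the arc. *)
Require Import Defs.
From mathcomp Require Import all_boot all_order all_algebra.
From mathcomp Require Import boolp classical_sets reals convex.
From mathcomp Require Import interval_inference ring lra.

Import Order.TTheory GRing.Theory Num.Theory.

Local Open Scope classical_set_scope.
Local Open Scope ring_scope.

Set Implicit Arguments.
Unset Strict Implicit.

(** Trades weights bundled in a unit-interval type for a plain scalar [t] with explicit bounds, on
    which [lra] and [nra] can work. *)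
Lemma convex_setP (R : realDomainType) (M : lmodType R) (A : set M) :
  @convex_set R M A <->
  forall (a b : M) (t : R), 0 <= t <= 1 -> A a -> A b ->
    A (t *: a + (1 - t) *: b).
Proof.
split=> [cA a b t /andP[t0 t1] Aa Ab | cA a b t /set_mem Aa /set_mem Ab].
  by have := cA a b (Itv01 t0 t1) (mem_set Aa) (mem_set Ab); move/set_mem.
by apply/mem_set/(cA a b) => //; apply/andP; split.
Qed.

Lemma between_conv (R : realFieldType) (a b c : R) : a <= b <= c ->
  exists2 t, 0 <= t <= 1 & b = t * a + (1 - t) * c.
Proof.
(* When [c <= a] the three numbers coincide and any weight will do. *)
case/andP=> ab bc; have [ac|ca] := ltP a c; last by exists 0; lra.
exists ((c - b) / (c - a)); last by field; lra.
by rewrite divr_ge0 ?ler_pdivrMr; lra.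
Qed.

Definition point3 {R : nzRingType} (x y z : R) : 'rV[R]_3 :=
  \row_(i < 3) [:: x; y; z]`_i.

Lemma point3_eta (R : nzRingType) (v : 'rV[R]_3) :
  v = point3 (v 0 0) (v 0 1) (v 0 2).
Proof.
apply/rowP=> -[[|[|[|i]]] hi]; rewrite ?mxE //=;
  by congr (v _ _); apply/val_inj.
Qed.

Lemma conv_point3 (R : nzRingType) (t x y z x' y' z' : R) :
  t *: point3 x y z + (1 - t) *: point3 x' y' z' =
  point3 (t * x + (1 - t) * x') (t * y + (1 - t) * y') (t * z + (1 - t) * z').
Proof. by apply/rowP=> -[[|[|[|i]]] hi]; rewrite !mxE. Qed.

(** After multiplication by [x * x'], the hypotheses scaled by [x' ^+ 2] and [x ^+ 2] bound
    [(z * x') ^+ 2 + (z' * x) ^+ 2], which is at least twice the product of [z * x'] and [z' * x].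
    This controls the cross term in the square of a convex combination. *)
Lemma rotated_cone_cross (R : realFieldType) (x z w x' z' w' : R) :
  0 < x -> 0 < x' -> z ^+ 2 <= x * w -> z' ^+ 2 <= x' * w' ->
  2 * (z * z') <= x * w' + x' * w.
Proof.
move=> x0 x'0 h h'; rewrite -(ler_pM2l (mulr_gt0 x0 x'0)).
have hd := sqr_ge0 (z * x' - z' * x).
have hz := ler_wpM2l (sqr_ge0 x') h; have hz' := ler_wpM2l (sqr_ge0 x) h'.
by nra.
Qed.

(** Clearing denominators leaves polynomial conditions. *)
Lemma S2_point3 (R : realType) (xl xu yl yu x z w : R) :
  0 < xl -> 0 < yl -> yl < yu ->
  S2 xl xu yl yu (point3 x z w) <->
  [/\ xl <= x <= xu, z ^+ 2 = x * w & yl * z <= x <= yu * z].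
Proof.
move=> hxl hyl hy; rewrite /S2 /= !mxE /=; split=> -[/andP[h1 h2]].
  have x0 : 0 < x by lra.
  rewrite ler_pdivrMr ?ler_pdivlMr//; last by lra.
  move=> /andP[h3 h4] ->; split; first by rewrite h1.
    by field; lra.
  by rewrite mulrC h4 mulrC.
have x0 : 0 < x by lra.
move=> hw /andP[h3 h4]; split; first by rewrite h1.
  by rewrite ler_pdivrMr ?ler_pdivlMr 1?mulrC ?h4 1?mulrC//; lra.
by rewrite hw mulrC mulKf//; lra.
Qed.

Lemma S2_relax_point3 (R : realType) (xl xu yl yu x z w : R) :
  S2_relax xl xu yl yu (point3 x z w) <->
  [/\ xl <= x <= xu, z ^+ 2 <= x * w &
      x + yl * yu * w <= (yl + yu) * z].
Proof. by rewrite /S2_relax /= !mxE. Qed.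

Lemma S2_sub_relax (R : realType) (xl xu yl yu : R) :
  0 < xl -> 0 < yl -> yl < yu ->
  S2 xl xu yl yu `<=` S2_relax xl xu yl yu.
Proof.
move=> hxl hyl hy v; rewrite (point3_eta v).
move: (v 0 0) (v 0 1) (v 0 2) => x z w.
move=> /(S2_point3 _ _ _ _ hxl hyl hy)[hx hw /andP[h1 h2]].
apply/S2_relax_point3; split=> //; first by rewrite hw.
have x0 : 0 < x by lra.
(* Since [z ^+ 2 = x * w], this product is [x] times the slack in the chord inequality. *)
have hp : 0 <= (x - yl * z) * (yu * z - x) by rewrite mulr_ge0; lra.
have hp' : yl * yu * z ^+ 2 = yl * yu * (x * w) by rewrite hw.
by rewrite -(ler_pM2l x0); lra.
Qed.

Lemma S2_relax_convex (R : realType) (xl xu yl yu : R) : 0 < xl ->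
  @convex_set R 'rV[R]_3 (S2_relax xl xu yl yu).
Proof.
move=> hxl; apply/convex_setP => a b t /andP[t0 t1].
rewrite (point3_eta a) (point3_eta b).
move: (a 0 0) (a 0 1) (a 0 2) (b 0 0) (b 0 1) (b 0 2) => x z w x' z' w'.
move=> /S2_relax_point3[/andP[h1 h2] h3 h4].
move=> /S2_relax_point3[/andP[h1' h2'] h3' h4'].
have x0 : 0 < x by lra.
have x'0 : 0 < x' by lra.
rewrite conv_point3; have s0 : 0 <= 1 - t by lra.
set s := 1 - t in s0 *; have st : s = 1 - t by [].
apply/S2_relax_point3; split.
- by apply/andP; split; nra.
(* Expand both sides in [t] and [s]: the [t ^+ 2], [s ^+ 2] and [t * s] terms are compared
   separately. *)
- have hc := ler_wpM2l (mulr_ge0 t0 s0) (rotated_cone_cross x0 x'0 h3 h3').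
  have ht := ler_wpM2l (sqr_ge0 t) h3; have hs := ler_wpM2l (sqr_ge0 s) h3'.
  by clearbody s; clear -hc ht hs; nra.
- have ht := ler_wpM2l t0 h4; have hs := ler_wpM2l s0 h4'.
  by clearbody s; clear -ht hs; nra.
Qed.

Lemma relax_sub_convex (R : realType) (xl xu yl yu : R) (C : set 'rV[R]_3) :
  0 < xl -> 0 < yl -> yl < yu -> convex_set C ->
  S2 xl xu yl yu `<=` C -> S2_relax xl xu yl yu `<=` C.
Proof.
move=> hxl hyl hy /convex_setP cC SC v; rewrite (point3_eta v).
move: (v 0 0) (v 0 1) (v 0 2) => x z w /S2_relax_point3[hx hw hc].
have [x0 yu0] : 0 < x /\ 0 < yu by lra.
(* Eliminate [w]: [yl * yu * z ^+ 2 <= yl * yu * x * w <= x * ((yl + yu) * z - x)], then factor. *)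
have hz : (yl * z - x) * (yu * z - x) <= 0.
  have hw' := ler_wpM2l (ltW (mulr_gt0 hyl yu0)) hw.
  have hc' := ler_wpM2l (ltW x0) hc.
  by nra.
have z0 : 0 < z.
  have w0 : 0 <= w by rewrite -(pmulr_rge0 _ x0) (le_trans (sqr_ge0 z)).
  have yw := mulr_ge0 (mulr_ge0 (ltW hyl) (ltW yu0)) w0.
  by rewrite -(pmulr_rgt0 _ (addr_gt0 hyl yu0)); lra.
(* As [z] is positive, this orders the two roots in [x] of the quadratic in [hz], so [x] lies
   between them. *)
have yz : yl * z <= yu * z by rewrite ler_pM2r// ltW.
have /andP[z1 z2] : yl * z <= x <= yu * z.
  rewrite !leNgt; apply/andP; split; apply/negP=> ltx.
    have := @mulr_gt0 _ (yl * z - x) (yu * z - x); lra.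
  have := @mulr_gt0 _ (x - yl * z) (x - yu * z); lra.
(* [SA] and [SB] are the end points of the arc, [SP] is its point at abscissa [z]. *)
have SA : C (point3 x (x / yl) (x / yl ^+ 2)).
  apply/SC/(S2_point3 _ _ _ _ hxl hyl hy); split=> //; first by field; lra.
  rewrite mulrCA divff ?mulr1 ?lexx /=; last by lra.
  by rewrite mulrA ler_pdivlMr// mulrC ler_pM2r// ltW.
have SB : C (point3 x (x / yu) (x / yu ^+ 2)).
  apply/SC/(S2_point3 _ _ _ _ hxl hyl hy); split=> //; first by field; lra.
  rewrite [yu * _]mulrCA divff ?mulr1 ?lexx ?andbT /=; last by lra.
  by rewrite mulrA ler_pdivrMr// mulrC ler_pM2l// ltW.
have SP : C (point3 x z (z ^+ 2 / x)).
  apply/SC/(S2_point3 _ _ _ _ hxl hyl hy); rewrite z1 z2.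
  by split=> //; field; lra.
(* The height of the chord at [z], obtained by solving the equality case of [hc] for [w]. *)
pose c := ((yl + yu) * z - x) / (yl * yu).
have SQ : C (point3 x z c).
  have [|t t01 zt] := @between_conv R (x / yu) z (x / yl).
    by rewrite ler_pdivrMr// ler_pdivlMr// mulrC z2 mulrC.
  have := cC _ _ t t01 SB SA; rewrite conv_point3 -zt.
  by congr (C (point3 _ _ _)); rewrite /c ?zt; field; lra.
have [|t t01 wt] := @between_conv R (z ^+ 2 / x) w c.
  (* The lower bound on [w] is [hw], the upper one is [hc]. *)
  rewrite ler_pdivrMr// ler_pdivlMr ?mulr_gt0//; nra.
have := cC _ _ t t01 SP SQ; rewrite conv_point3 -wt.
by congr (C (point3 _ _ _)); ring.
Qed.

Theorem proposition2 (R : realType) (xl xu yl yu : R)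
    (hxl : 0 < xl) (hx : xl < xu) (hyl : 0 < yl) (hy : yl < yu) :
  convex_hull (S2 xl xu yl yu) = S2_relax xl xu yl yu.
Proof.
apply/seteqP; split=> [|v Rv C [cC SC]]; last first.
  exact: (relax_sub_convex hxl hyl hy cC SC).
apply: smallest_sub; first exact: S2_relax_convex.
exact: S2_sub_relax.
Qed.
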